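(* Let $\alpha\in[0,1]$, let $F_s\neq F_b$ be cumulative distribution functions (CDFs) on $\mathbb{R}$, and let $F=\alpha F_s+(1-\alpha)F_b$. Let $$\alpha_0:=\inf\{\gamma\in(0,1]: [F-(1-\gamma)F_b]/\gamma \text{ is a CDF}\}.$$ Then $$\alpha_0=\alpha-\sup\{0\le\epsilon\le 1:\ \alpha F_s-\epsilon F_b \text{ is a sub-CDF}\}.$$ In particular, $\alpha_0<\alpha$ if and only if there exists $\epsilon\in(0,1)$ such that $\alpha F_s-\epsilon F_b$ is a sub-CDF. Furthermore, $\alpha_0=0$ if and only if $F=F_b$.
   Context: A sub-CDF is a non-decreasing right-continuous function $\mathbb{R}\to\mathbb{R}$ taking values between $0$ and $1$. *)

(* Defs.v *)
From HB Require Import structures.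
From mathcomp Require Import all_boot all_order all_algebra.
From mathcomp Require Import all_classical all_reals all_analysis.
Import Order.TTheory GRing.Theory Num.Theory.
Import numFieldNormedType.Exports.

Set Implicit Arguments.
Unset Strict Implicit.
Unset Printing Implicit Defensive.

Local Open Scope classical_set_scope.
Local Open Scope ring_scope.

Definition is_cdf (R : realType) (f : R -> R) : Prop :=
  exists g : cumulativeBounded (0 : R) (1 : R), f = g :> (R -> R).

Lemma is_cdfP (R : realType) (f : R -> R) :
  is_cdf f <->
  [/\ nondecreasing_fun f, right_continuous f,
      f x @[x --> -oo] --> (0 : R) & f x @[x --> +oo] --> (1 : R)].
Proof.
split=> [[g ->]|[ndf rcf f0 f1]].
  split; [exact: cumulative_is_nondecreasing
    | exact: cumulative_is_right_continuous
    | exact: cumulativeNy | exact: cumulativey].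
pose fc := isCumulative.Build R _ _ f ndf rcf.
pose fb := isCumulativeBounded.Build R 0 1 f f0 f1.
pose g : cumulativeBounded (0 : R) 1 := HB.pack f fc fb.
by exists g.
Qed.

Definition is_sub_cdf (R : realType) (f : R -> R) : Prop :=
  [/\ nondecreasing_fun f, right_continuous f & forall x, 0 <= f x <= 1].

Definition mixture (R : realType) (alpha : R) (Fs Fb : R -> R) : R -> R :=
  fun x => alpha * Fs x + (1 - alpha) * Fb x.

(* [inf] is only meaningful on nonempty sets bounded below; here the set lies
   in ]0, 1] and contains 1 as soon as F is a CDF. *)
Definition alpha0 (R : realType) (F Fb : R -> R) : R :=
  inf [set gamma | 0 < gamma <= 1 /\
                   is_cdf (fun x => (F x - (1 - gamma) * Fb x) / gamma)].

(* Main.v *)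
(* Write G_eps = alpha * Fs - eps * Fb.  Since F - (1 - gamma) * Fb =
   G_(alpha - gamma), and since G_eps is right-continuous with limits 0 and
   alpha - eps, both "CDF after division by gamma" and "sub-CDF" reduce to
   monotonicity of G_eps.  So gamma <-> alpha - eps matches the two index sets,
   except for the values gamma >= alpha, which are always admissible, and for
   eps = alpha, which is admissible only if alpha = 0 because G_alpha vanishes
   at both ends and Fs <> Fb.  Finally, monotonicity of G_eps is a closed
   condition on eps, so alpha0 = 0 forces G_alpha to be monotone. *)
Require Import Defs.
From HB Require Import structures.
From mathcomp Require Import all_boot all_order all_algebra.
From mathcomp Require Import all_classical all_reals all_analysis.
From mathcomp Require Import ring lra.
Import Order.TTheory GRing.Theory Num.Theory.
Import numFieldNormedType.Exports.

Local Open Scope classical_set_scope.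
Local Open Scope ring_scope.

Lemma nondecreasing_between_limits (R : realType) (f : R -> R) (l u : R) :
  nondecreasing_fun f -> f x @[x --> -oo] --> l -> f x @[x --> +oo] --> u ->
  forall x, l <= f x <= u.
Proof.
move=> ndf fl fu x; apply/andP; split.
  by apply: (cvgr_to_le fl); near=> y; apply: ndf; near: y;
    apply: nbhs_ninfty_le; rewrite num_real.
by apply: (cvgr_to_ge fu); near=> y; apply: ndf; near: y;
  apply: nbhs_pinfty_ge; rewrite num_real.
Unshelve. all: by end_near. Qed.

Lemma cdf_difference_limits (R : realType) (f g : R -> R) (a b : R) :
  is_cdf f -> is_cdf g ->
  [/\ right_continuous (fun x => a * f x - b * g x),
      a * f x - b * g x @[x --> -oo] --> (0 : R) &
      a * f x - b * g x @[x --> +oo] --> a - b].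
Proof.
move=> /is_cdfP[_ rf f0 f1] /is_cdfP[_ rg g0 g1].
split=> [x||].
- exact: (cvgB (cvgM (cvg_cst a) (rf x)) (cvgM (cvg_cst b) (rg x))).
- have <- : a * 0 - b * 0 = 0 by ring.
  exact: (cvgB (cvgM (cvg_cst a) f0) (cvgM (cvg_cst b) g0)).
- have <- : a * 1 - b * 1 = a - b by ring.
  exact: (cvgB (cvgM (cvg_cst a) f1) (cvgM (cvg_cst b) g1)).
Qed.

(** A monotone function stays between its limits, here [0] and [a - b], and [a - b <= 1]. *)
Lemma sub_cdf_differenceP (R : realType) (f g : R -> R) (a b : R) :
  a <= 1 -> 0 <= b -> is_cdf f -> is_cdf g ->
  is_sub_cdf (fun x => a * f x - b * g x) <->
  nondecreasing_fun (fun x => a * f x - b * g x).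
Proof.
move=> a1 b0 cf cg; have [rc l0 l1] := cdf_difference_limits _ _ _ a b cf cg.
split=> [[]//|nd]; split=> // x.
have := nondecreasing_between_limits _ _ _ _ nd l0 l1 x; lra.
Qed.

Lemma nondecreasing_difference_le (R : realType) (f g : R -> R) (a b : R) :
  is_cdf f -> is_cdf g -> nondecreasing_fun (fun x => a * f x - b * g x) ->
  b <= a.
Proof.
move=> cf cg nd; have [_ l0 l1] := cdf_difference_limits _ _ _ a b cf cg.
have := nondecreasing_between_limits _ _ _ _ nd l0 l1 0; lra.
Qed.

(** Both limits are [0], so monotonicity forces [a * f = a * g] everywhere; cancelling a nonzero [a]
    would give [f = g]. *)
Lemma nondecreasing_difference_eq0 (R : realType) (f g : R -> R) (a : R) :
  is_cdf f -> is_cdf g -> f <> g ->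
  nondecreasing_fun (fun x => a * f x - a * g x) -> a = 0.
Proof.
move=> cf cg fg nd; apply/eqP; apply: contra_notT fg => a0.
have [_ l0 l1] := cdf_difference_limits _ _ _ a a cf cg.
apply/funext => x; apply: (mulfI a0); apply/eqP; rewrite -subr_eq0 eq_le.
by have := nondecreasing_between_limits _ _ _ _ nd l0 l1 x; rewrite subrr andbC.
Qed.

(** The numerator equals [a * f - (a - gamma) * g], whose limit at [+oo] is exactly [gamma], so the
    division normalises it to [1]. The sign of [a - gamma] is left free, to cover [gamma >= a] as
    well. *)
Lemma cdf_unmixP (R : realType) (a gamma : R) (f g : R -> R) :
  0 < gamma -> is_cdf f -> is_cdf g ->
  is_cdf (fun x => (mixture a f g x - (1 - gamma) * g x) / gamma) <->
  nondecreasing_fun (fun x => a * f x - (a - gamma) * g x).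
Proof.
move=> g0 cf cg.
have -> : (fun x => (mixture a f g x - (1 - gamma) * g x) / gamma) =
    (fun x => a / gamma * f x - (a - gamma) / gamma * g x).
  by apply/funext => x; rewrite /mixture; field; rewrite gt_eqF.
have -> : (fun x => a / gamma * f x - (a - gamma) / gamma * g x) =
    (fun x => gamma^-1 * (a * f x - (a - gamma) * g x)).
  by apply/funext => x; field; rewrite gt_eqF.
have gV : 0 < gamma^-1 by rewrite invr_gt0.
split=> [/is_cdfP[nd _ _ _] x y xy|nd].
  by have := nd _ _ xy; rewrite ler_pM2l.
have [rc l0 l1] := cdf_difference_limits _ _ _ a (a - gamma) cf cg.
apply/is_cdfP; split.
- by move=> x y xy; rewrite ler_pM2l//; exact: nd.
- by move=> x; exact: (cvgM (cvg_cst _) (rc x)).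
- rewrite -[X in _ --> X](mulr0 gamma^-1).
  exact: (cvgM (cvg_cst _) l0).
- have <- : gamma^-1 * (a - (a - gamma)) = 1 by field; rewrite gt_eqF.
  exact: (cvgM (cvg_cst _) l1).
Qed.

Theorem lemma2 (R : realType) (alpha : R) (Fs Fb : R -> R)
    (halpha : 0 <= alpha <= 1) (hFs : is_cdf Fs) (hFb : is_cdf Fb)
    (hne : Fs <> Fb) :
  let F := mixture alpha Fs Fb in
  [/\ alpha0 F Fb = alpha - sup [set eps | 0 <= eps <= 1 /\
                      is_sub_cdf (fun x => alpha * Fs x - eps * Fb x)],
      alpha0 F Fb < alpha <->
        exists eps : R, 0 < eps < 1 /\
          is_sub_cdf (fun x => alpha * Fs x - eps * Fb x)
    & alpha0 F Fb = 0 <-> F = Fb].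
Proof.
move=> F.
have /andP[al0 al1] := halpha.
have ndb x y : x <= y -> Fb x <= Fb y by have /is_cdfP[+ _ _ _] := hFb; apply.
have nds x y : x <= y -> Fs x <= Fs y by have /is_cdfP[+ _ _ _] := hFs; apply.
set E := [set eps | _ ]; set m := sup E.
(* With the bound [Ele], this makes [sup E] a true supremum instead of the default value [0]. *)
have E0 : E 0.
  split; first lra; apply/sub_cdf_differenceP => // x y /nds xy.
  by rewrite !mul0r !subr0 ler_wpM2l.
have Ele e : E e -> e <= alpha.
  by case=> ? [nd _ _]; exact: nondecreasing_difference_le hFs hFb nd.
have Em e : E e -> e <= m by apply: ub_le_sup; exists alpha.
have mle u : (forall e, E e -> e <= u) -> m <= u.
  by move=> Eu; apply: ge_sup; first by exists 0.
have m0 := Em _ E0; have mal := mle _ Ele.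
have Elt e : 0 < alpha -> E e -> e < alpha.
  move=> al_gt0 Ee; rewrite lt_neqAle Ele// andbT.
  apply/eqP => eal; case: Ee => _ [nd _ _]; move: nd; rewrite eal.
  by move/(nondecreasing_difference_eq0 _ _ _ _ hFs hFb hne) => al; lra.
have main : alpha0 F Fb = alpha - m.
  rewrite /alpha0; set S := [set gamma | _].
  have Slb gamma : S gamma -> alpha - m <= gamma.
    case=> /andP[g0 g1] /cdf_unmixP-/(_ g0 hFs hFb) nd.
    (* For [alpha <= gamma] the bound is just [0 <= m]. *)
    have [ag|ag] := leP alpha gamma; first lra.
    have /Em : E (alpha - gamma).
      by split; [lra|apply/sub_cdf_differenceP => //; lra].
    lra.
  have Sge gamma : 0 < gamma <= 1 -> alpha <= gamma -> S gamma.
    move=> g01 ag; split=> //; apply/cdf_unmixP => //; first lra.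
    (* Both weights [alpha] and [gamma - alpha] are nonnegative here. *)
    move=> x y xy; have := nds _ _ xy; have := ndb _ _ xy; nra.
  have Sinf gamma : S gamma -> inf S <= gamma.
    by apply: ge_inf; exists (alpha - m).
  apply/eqP; rewrite eq_le; apply/andP; split; last first.
    by apply: lb_le_inf => //; exists 1; apply: Sge; lra.
  (* If [alpha > 0], the strict bound [Elt] makes [gamma = alpha - e] positive, hence admissible for
     every [e] in [E]. *)
  have [al_gt0|al_le0] := ltP 0 alpha.
    suff : m <= alpha - inf S by lra.
    apply: mle => e Ee; suff : inf S <= alpha - e by lra.
    apply: Sinf; have := Elt _ al_gt0 Ee; case: Ee => ? [nd _ _] ?.
    split; first lra; apply/cdf_unmixP => //; first lra.
    by rewrite subKr.
  (* Now [alpha = 0]: the infimum [0] is not attained, but every [gamma] in []0, 1]] is admissible;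
     the minimum with [1] keeps [gamma] in that range. *)
  have -> : alpha - m = 0 by lra.
  apply/ler_addgt0Pr => e e0; rewrite add0r.
  apply: (@le_trans _ _ (Num.min e 1)); last by rewrite ge_min lexx.
  apply: Sinf; apply: Sge; first by rewrite lt_min e0 ltr01 ge_min lexx orbT.
  by rewrite le_min; lra.
split=> //.
- rewrite main; split=> [mgt|[e [e01 se]]]; last first.
    have /Em : E e by split=> //; lra.
    lra.
  have m_gt0 : 0 < m by lra.
  have [e Ee e0] : exists2 e, E e & 0 < e.
    by have [e Ee ?] := sup_gt (ex_intro _ _ E0) m_gt0; exists e.
  exists e; split; last by case: Ee.
  by have := Elt e _ Ee; lra.
- rewrite main; split=> [ma|FFb].
    have nd : nondecreasing_fun (fun x => alpha * Fs x - alpha * Fb x).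
      (* Closedness in [eps], pointwise: if [Fb] increases strictly from [x] to [y], monotonicity
         bounds each [e] in [E] by a fixed quotient of increments, hence also the supremum
         [m = alpha]. Otherwise the [Fb] terms cancel. *)
      move=> x y xy; have := ndb _ _ xy; rewrite le_eqVlt => /orP[/eqP ->|bxy].
        by have := nds _ _ xy; nra.
      have d0 : 0 < Fb y - Fb x by lra.
      have : m <= alpha * (Fs y - Fs x) / (Fb y - Fb x).
        apply: mle => e [_ [nd _ _]]; rewrite ler_pdivlMr//.
        by have := nd _ _ xy; lra.
      have -> : m = alpha by lra.
      by rewrite ler_pdivlMr//; lra.
    have al := nondecreasing_difference_eq0 _ _ _ _ hFs hFb hne nd.
    by apply/funext => x; rewrite /F /mixture al; ring.
  have al : alpha = 0.
    (* [F = Fb] says that [alpha * Fs - alpha * Fb] is identically [0], so it is trivially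
       monotone. *)
    apply: (nondecreasing_difference_eq0 _ _ _ _ hFs hFb hne) => x y _.
    have := congr1 (@^~ x) FFb; have := congr1 (@^~ y) FFb.
    rewrite /F /mixture; lra.
  lra.
Qed.
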